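(* Let $Q$ be a finite (left) quasifield with $q$ elements. If $P$ is a set of points and $L$ is a set of lines in $Q^2$, then \[ |\{(p,l)\in P\times L : p \in l\}| \leq \frac{|P||L|}{q} + q^{1/2}\sqrt{|P||L|}. \]
   Context: A (left) quasifield is a set $Q$ with two binary operations $+$ and $\cdot$ such that $(Q,+)$ is a group with identity $0$; $(Q\setminus\{0\},\cdot)$ is a loop (for all $a,b$ the equations $a\cdot x=b$ and $y\cdot a=b$ have unique solutions, and there is an identity $1$); $a\cdot(b+c)=a\cdot b+a\cdot c$ for all $a,b,c$; $0\cdot x=0$ for all $x$; and for $a\neq b$ the equation $a\cdot x=b\cdot x+c$ has exactly one solution $x$. A line in $Q^2$ is, for some $a,b\in Q$, a set of the form $\{(x,y)\in Q^2 : y = b\cdot x + a\}$ or $\{(a,y): y\in Q\}$. *)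

(* Defs.v *)
From HB Require Import structures.
From mathcomp Require Import all_boot all_order all_algebra.

Set Implicit Arguments.
Unset Strict Implicit.
Unset Printing Implicit Defensive.

(* Commutativity is not assumed: (Q, +) is only required to be a group. *)
Definition is_group (T : Type) (op : T -> T -> T) (e : T) : Prop :=
  [/\ associative op,
      left_id e op,
      right_id e op
    & forall x, exists y, op y x = e /\ op x y = e].

(* [D] is the carrier of the loop, as a subset of [T]; the first clause says
   that [op] restricts to a binary operation on [D], and the solutions of the
   equations are sought in [D]. *)
Definition is_loop (T : Type) (D : T -> Prop) (op : T -> T -> T) (e : T) :
    Prop :=
  [/\ forall a b, D a -> D b -> D (op a b),
      D e /\ (forall a, D a -> op e a = a /\ op a e = a),
      forall a b, D a -> D b -> exists! x, D x /\ op a x = b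
    & forall a b, D a -> D b -> exists! y, D y /\ op y a = b].

Record is_left_quasifield (Q : Type) (add mul : Q -> Q -> Q) (zero one : Q) :
    Prop := IsLeftQuasifield {
  quasifield_add_group : is_group add zero;
  quasifield_mul_loop : is_loop (fun x => x <> zero) mul one;
  quasifield_mulDr : forall a b c,
    mul a (add b c) = add (mul a b) (mul a c);
  quasifield_mul0l : forall x, mul zero x = zero;
  quasifield_planar : forall a b c,
    a <> b -> exists! x, mul a x = add (mul b x) c
}.

Section Lines.
Variables (Q : finType) (add mul : Q -> Q -> Q).

Definition slope_line (b a : Q) : {set Q * Q} :=
  [set p | p.2 == add (mul b p.1) a].

Definition vertical_line (a : Q) : {set Q * Q} := [set p | p.1 == a].

Definition is_line (l : {set Q * Q}) : Prop :=
  exists a b, l = slope_line b a \/ l = vertical_line a.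

End Lines.

Definition incidences (Q : finType) (P : {set Q * Q}) (L : {set {set Q * Q}}) :
    {set (Q * Q) * {set Q * Q}} :=
  [set pl in setX P L | pl.1 \in pl.2].

(* Main.v *)
(** Let [x_l] be the number of points of [P] on the line [l].  Every point lies
    on [q + 1] of the [q ^ 2 + q] lines and two distinct points lie on at most
    one, so summing over all lines gives [\sum x_l = (q + 1) |P|] and
    [\sum x_l ^ 2 <= |P| ^ 2 + q |P|], hence
    [\sum (x_l - |P| / q) ^ 2 <= q |P|].  The incidence count minus
    [|P| |L| / q] is the sum of [x_l - |P| / q] over [L], so Cauchy-Schwarz
    concludes. *)

Require Import Defs.
From mathcomp Require Import all_boot all_order all_algebra.
From mathcomp Require Import ring.
Import Order.TTheory GRing.Theory Num.Theory.
Local Open Scope ring_scope.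

Set Implicit Arguments.
Unset Strict Implicit.
Unset Printing Implicit Defensive.

(** Expanding the nonnegative sum of [(n * f i - s) ^+ 2] gives [n] times the difference of the two
    sides. Dividing by [n] requires [A] to be nonempty. *)
Lemma sqr_sum_le_card (R : realFieldType) (I : finType) (A : {set I})
    (f : I -> R) :
  (\sum_(i in A) f i) ^+ 2 <= #|A|%:R * \sum_(i in A) f i ^+ 2.
Proof.
set n : R := #|A|%:R; set s := \sum_(i in A) f i.
have [A0|A_gt0] := posnP #|A|.
  by rewrite /s /n (cards0_eq A0) big_set0 cards0 expr0n mul0r.
have n_gt0 : 0 < n by rewrite ltr0n.
have : 0 <= \sum_(i in A) (n * f i - s) ^+ 2.
  by apply: sumr_ge0 => i _; exact: sqr_ge0.
have -> : \sum_(i in A) (n * f i - s) ^+ 2 =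
    n * (n * (\sum_(i in A) f i ^+ 2) - s ^+ 2).
  rewrite (eq_bigr (fun i => n ^+ 2 * f i ^+ 2 - 2 * n * s * f i + s ^+ 2));
    last by move=> i _; ring.
  rewrite big_split /= sumrB sumr_const -!mulr_sumr -[s ^+ 2 *+ _]mulr_natl.
  by rewrite -/s -/n; ring.
by rewrite pmulr_rge0 // subr_ge0.
Qed.

Lemma cardsI_sum (T : finType) (A B : {set T}) :
  #|A :&: B| = (\sum_(x in A) (x \in B))%N.
Proof.
rewrite -sum1_card big_mkcond [RHS]big_mkcond; apply: eq_bigr => x _.
by rewrite inE; case: (x \in A); case: (x \in B).
Qed.

(** * Second moment bound for block incidences *)

Section IncidenceStructure.
Variables (T I : finType) (B : I -> {set T}) (q : nat).
Hypothesis card_index : #|I| = (q * q + q)%N.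
Hypothesis card_through : forall p, #|[set i | p \in B i]| = q.+1.
Hypothesis card_through2 :
  forall p p', p != p' -> (#|[set i | (p \in B i) && (p' \in B i)]| <= 1)%N.

Lemma sum_card_blockI (P : {set T}) :
  (\sum_i #|P :&: B i| = q.+1 * #|P|)%N.
Proof.
under eq_bigr do rewrite cardsI_sum.
rewrite exchange_big /= mulnC -sum_nat_const; apply: eq_bigr => p _.
by rewrite -(card_through p) -sum1dep_card [RHS]big_mkcond.
Qed.

(** The sum counts triples of a block and two points of [P] on it. For fixed [p], the choice
    [p' = p] contributes [q + 1] and each of the [#|P| - 1] others at most 1. *)
Lemma sum_sqr_card_blockI (P : {set T}) :
  (\sum_i #|P :&: B i| ^ 2 <= #|P| ^ 2 + q * #|P|)%N.
Proof.
rewrite (eq_bigr (fun i => \sum_(p in P) \sum_(p' in P)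
    ((p \in B i) && (p' \in B i))))%N; last first.
  move=> i _; rewrite expnS expn1 cardsI_sum big_distrl /=.
  by apply: eq_bigr => p _; rewrite big_distrr /=; apply: eq_bigr => p' _;
    rewrite mulnb.
rewrite exchange_big /=.
have -> : (#|P| ^ 2 + q * #|P| = \sum_(p in P) (#|P| + q))%N.
  by rewrite sum_nat_const mulnDr [(q * _)%N]mulnC.
apply: leq_sum => p pP; rewrite exchange_big /= (bigD1 p) //=.
have -> : (#|P| + q = q.+1 + #|P :\ p|)%N.
  by rewrite (cardsD1 p P) pP add1n addSn addnC addSn.
apply: leq_add.
  rewrite -(card_through p) -sum1dep_card [leqRHS]big_mkcond /=.
  by apply: leq_sum => i _; rewrite andbb.
rewrite -[#|P :\ p|]muln1 -sum_nat_const [leqRHS](eq_bigl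
    (fun p' => (p' \in P) && (p' != p))); last by move=> p'; rewrite !inE andbC.
apply: leq_sum => p' /andP[_ p'p].
rewrite eq_sym in p'p; have := card_through2 p'p.
by rewrite -sum1dep_card big_mkcond.
Qed.

Lemma sum_sqr_dev_blockI (R : realFieldType) (P : {set T}) : (0 < q)%N ->
  \sum_i (#|P :&: B i|%:R - #|P|%:R / q%:R) ^+ 2 <= q%:R * #|P|%:R :> R.
Proof.
move=> q_gt0; have q_neq0 : q%:R != 0 :> R by rewrite pnatr_eq0 -lt0n.
set m : R := _ / _.
rewrite (eq_bigr (fun i => #|P :&: B i|%:R ^+ 2 - 2 * m * #|P :&: B i|%:R
    + m ^+ 2)); last by move=> i _; ring.
rewrite big_split /= sumrB sumr_const -mulr_sumr -natr_sum sum_card_blockI.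
under eq_bigr do rewrite -natrX.
rewrite -natr_sum card_index -[_ *+ (_ + _)]mulr_natr.
have : (\sum_i #|P :&: B i| ^ 2)%:R <= (#|P| ^ 2 + q * #|P|)%:R :> R.
  by rewrite ler_nat sum_sqr_card_blockI.
rewrite !natrD natrX !natrM.
(* Eliminating [#|P|] leaves a polynomial inequality in [m] and [q], with slack [m ^+ 2 * q]. *)
have -> : #|P|%:R = m * q%:R :> R by rewrite divfK.
set r : R := q%:R => le_s.
rewrite -lerBrDr lerBlDr; apply: le_trans le_s _.
rewrite -subr_ge0 (_ : _ - _ = m ^+ 2 * r); last by ring.
by rewrite mulr_ge0 ?sqr_ge0 ?ler0n.
Qed.

Lemma sum_card_blockI_le (R : rcfType) (P : {set T}) (J : {set I}) :
    (0 < q)%N ->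
  \sum_(i in J) #|P :&: B i|%:R <=
    #|P|%:R * #|J|%:R / q%:R + Num.sqrt q%:R * Num.sqrt (#|P|%:R * #|J|%:R)
    :> R.
Proof.
move=> q_gt0; set m : R := #|P|%:R / q%:R.
have -> : #|P|%:R * #|J|%:R / q%:R = \sum_(i in J) m :> R.
  by rewrite sumr_const -[m *+ _]mulr_natr /m mulrAC.
rewrite -lerBlDl -sumrB -sqrtrM ?ler0n //.
(* The deviation is at most the square root of its square, so it suffices to compare squares. *)
apply: le_trans (ler_norm _) _; rewrite -sqrtr_sqr ler_wsqrtr //.
apply: le_trans (sqr_sum_le_card _ _) _.
rewrite mulrA [leRHS]mulrC ler_wpM2l ?ler0n //.
apply: le_trans _ (sum_sqr_dev_blockI _ P q_gt0).
(* Passing from [J] to all indices only adds squares. *)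
rewrite [leLHS]big_mkcond; apply: ler_sum => i _.
by case: ifP => // _; exact: sqr_ge0.
Qed.

End IncidenceStructure.

(** * The affine plane over a quasifield *)

Section QuasifieldPlane.
Variables (Q : finType) (add mul : Q -> Q -> Q) (zero one : Q).
Hypothesis hQ : is_left_quasifield add mul zero one.

Lemma qf_addA : associative add.
Proof. by case: (quasifield_add_group hQ). Qed.

Lemma qf_add0 : right_id zero add.
Proof. by case: (quasifield_add_group hQ). Qed.

Lemma qf_addI x : injective (add x).
Proof.
have [addA add0x _ addN] := quasifield_add_group hQ.
have [x' [x'x _]] := addN x.
by move=> y z /(congr1 (add x')); rewrite !addA x'x !add0x.
Qed.

Lemma qf_addIr x : injective (add^~ x).
Proof.
have [addA _ addx0 addN] := quasifield_add_group hQ.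
have [x' [_ xx']] := addN x.
by move=> y z /(congr1 (add^~ x')); rewrite -!addA xx' !addx0.
Qed.

Lemma qf_subr x y : exists z, add x z = y.
Proof.
have [addA add0x _ addN] := quasifield_add_group hQ.
have [x' [_ xx']] := addN x.
by exists (add x' y); rewrite addA xx' add0x.
Qed.

Lemma qf_mul0 b : mul b zero = zero.
Proof.
apply: (@qf_addI (mul b zero)).
by rewrite -(quasifield_mulDr hQ) !qf_add0.
Qed.

(** For distinct [b] and [b'], planarity with [c = zero] gives a single solution of [b x = b' x],
    and [zero] already is one. *)
Lemma qf_mul_slopeI b b' d : d != zero -> mul b d = mul b' d -> b = b'.
Proof.
move=> /eqP d0 bd; apply/eqP/negPn/negP => /eqP bb'.
have [x [_ xuniq]] := quasifield_planar hQ zero bb'.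
apply: d0; rewrite -(xuniq d) ?qf_add0 // -(xuniq zero) //.
by rewrite qf_add0 !qf_mul0.
Qed.

(** Indexing lines by their parameters turns the count [q ^ 2 + q] into a count of indices. *)
Definition plane_line (i : Q * Q + Q) : {set Q * Q} :=
  match i with
  | inl ba => slope_line add mul ba.1 ba.2
  | inr a => vertical_line a
  end.

Lemma card_plane_line_index : #|{: Q * Q + Q}| = (#|Q| * #|Q| + #|Q|)%N.
Proof. by rewrite card_sum card_prod. Qed.

Lemma card_plane_line_through p :
  #|[set i | p \in plane_line i]| = #|Q|.+1.
Proof.
(* [sol b] is the intercept of the line of slope [b] through [p]; it always exists, so the default
   [zero] is never reached. These [q] lines and one vertical line make [q + 1]. *)
have [sol solP] : exists sol : Q -> Q, forall b, add (mul b p.1) (sol b) = p.2.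
  exists (fun b => odflt zero [pick a | add (mul b p.1) a == p.2]) => b.
  case: pickP => [a /eqP //|none] /=.
  by have [z /eqP] := qf_subr (mul b p.1) p.2; rewrite none.
have -> : [set i | p \in plane_line i] =
    (inr p.1 : Q * Q + Q) |: [set inl (b, sol b) | b : Q].
  apply/setP => -[[b a]|a]; rewrite !inE /=.
    apply/eqP/imsetP => [pE|[b' _ [-> ->]]]; last by rewrite solP.
    exists b => //; congr (inl (_, _)).
    by apply: (@qf_addI (mul b p.1)); rewrite solP.
  rewrite eq_sym; have [->|ap] := eqVneq a p.1; first by rewrite eqxx.
  apply/esym/norP; split; first by apply: contra_neq ap => -[].
  by apply/negP => /imsetP[].
rewrite cardsU1 card_imset; last by move=> b b' [].
suff -> : inr p.1 \notin [set inl (b, sol b) | b : Q] :> bool by [].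
by apply/negP => /imsetP[].
Qed.

Lemma card_plane_line_through2 p p' : p != p' ->
  (#|[set i | (p \in plane_line i) && (p' \in plane_line i)]| <= 1)%N.
Proof.
case: p p' => [x y] [x' y'] pp'; apply/card_le1_eqP => i j.
(* On a sloped line the abscissa determines the ordinate, so equal abscissas force both lines to be
   vertical; distinct ones force both to be sloped. *)
have [xx'|xx'] := eqVneq x x'.
  subst x'; have yy' : y <> y' by move=> yy'; rewrite yy' eqxx in pp'.
  case: i j => [[b a]|a] [[b' a']|a']; rewrite !inE /=.
  - by move=> /andP[/eqP yE /eqP y'E]; case: yy'; rewrite yE y'E.
  - by move=> /andP[/eqP yE /eqP y'E]; case: yy'; rewrite yE y'E.
  - by move=> _ /andP[/eqP yE /eqP y'E]; case: yy'; rewrite yE y'E.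
  - by move=> /andP[/eqP<- _] /andP[/eqP<- _].
case: i j => [[b a]|a] [[b' a']|a']; rewrite !inE /=; last 3 first.
- by move=> _ /andP[/eqP xE /eqP x'E]; rewrite xE x'E eqxx in xx'.
- by move=> /andP[/eqP xE /eqP x'E]; rewrite xE x'E eqxx in xx'.
- by move=> /andP[/eqP xE /eqP x'E]; rewrite xE x'E eqxx in xx'.
move=> /andP[/eqP yE /eqP y'E] /andP[/eqP yE' /eqP y'E'].
(* With [x = d + x'] and [y = e + y'], the slope satisfies [b d = e]. *)
have [_ add0x _ addN] := quasifield_add_group hQ.
have [nx [nxx _]] := addN x'; have [ny [nyy _]] := addN y'.
set d := add x nx; set e := add y ny.
have dE : add d x' = x by rewrite /d -qf_addA nxx qf_add0.
have eE : add e y' = y by rewrite /e -qf_addA nyy qf_add0.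
(* Left distributivity gives [y = c d + (c x' + k) = c d + y'], and [y'] cancels on the right. *)
have slope c k : y = add (mul c x) k -> y' = add (mul c x') k -> mul c d = e.
  move=> yk y'k; apply: (@qf_addIr y').
  by rewrite eE [in RHS]yk -dE (quasifield_mulDr hQ) y'k qf_addA.
have d0 : d != zero.
  by apply: contra_neq xx' => d0; rewrite -dE d0 add0x.
have bb' : b = b'.
  by apply: (qf_mul_slopeI d0); rewrite (slope b a) // (slope b' a').
subst b'; congr (inl (_, _)).
by apply: (@qf_addI (mul b x)); rewrite -yE.
Qed.

End QuasifieldPlane.

(** * The incidence bound *)

Lemma card_incidences (Q : finType) (P : {set Q * Q}) (L : {set {set Q * Q}}) :
  #|incidences P L| = (\sum_(l in L) #|P :&: l|)%N.
Proof.
rewrite -sum1_card.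
rewrite [RHS](eq_bigr (fun l : {set Q * Q} =>
    \sum_(p in P | p \in l) 1))%N; last first.
  by move=> l _; rewrite -sum1_card; apply: eq_bigl => p; rewrite inE.
rewrite [RHS](exchange_big_dep (mem P)) /=; last by move=> l p _ /andP[].
rewrite pair_big_dep /=; apply: eq_bigl => -[p l]; rewrite !inE /=.
by case: (p \in P); case: (l \in L).
Qed.

Theorem theorem1p6 (R : rcfType) (Q : finType) (add mul : Q -> Q -> Q)
    (zero one : Q) (q : nat) (P : {set Q * Q}) (L : {set {set Q * Q}})
    (hQ : is_left_quasifield add mul zero one)
    (hq : #|Q| = q)
    (hL : forall l : {set Q * Q}, l \in L -> is_line add mul l) :
  (#|incidences P L|%:R : R) <=
    #|P|%:R * #|L|%:R / q%:R + Num.sqrt q%:R * Num.sqrt (#|P|%:R * #|L|%:R).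
Proof.
subst q; pose line := plane_line add mul.
pose index l := odflt (inr zero) [pick i | line i == l].
have indexK : {in L, cancel index line}.
  move=> l /hL [a [b lE]]; rewrite /index; case: pickP => [i /eqP //|none].
  by case: lE => lE; [have := none (inl (b, a)) | have := none (inr a)];
    rewrite lE eqxx.
have index_inj : {in L &, injective index} := can_in_inj indexK.
have Q_gt0 : (0 < #|Q|)%N by apply/card_gt0P; exists zero.
have := @sum_card_blockI_le _ _ line #|Q| (card_plane_line_index Q)
  (card_plane_line_through hQ) (card_plane_line_through2 hQ)
  R P (index @: L) Q_gt0.
rewrite card_in_imset // big_imset //= card_incidences natr_sum.
by rewrite (eq_bigr (fun l => #|P :&: l|%:R)) // => l lL; rewrite indexK.
Qed.
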